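(* Let $\mathcal{G}$ and $\mathcal{H}$ be ultragraphs without sinks, with associated ultragraph shift spaces $X_{\mathcal{G}}$ and $X_{\mathcal{H}}$. A map $\Phi:X_{\mathcal{G}}\to X_{\mathcal{H}}$ is continuous, shift commuting, and preserves length (i.e. $|\Phi(x)|=|x|$ for all $x\in X_{\mathcal{G}}$) if, and only if, it is a generalized sliding block code given by $$\bigl(\Phi(x)\bigr)_n=\sum_{a\in \mathbf{A}_{\mathcal{H}}}a\,\mathbf{1}_{C_a}\circ\sigma^{n-1}(x)\quad (x\in X_{\mathcal{G}},\ n\ge1)$$ where: (i) for each $a\in\mathbf{A}_{\mathcal{H}}\setminus\mathfrak{p}^0_{\mathcal{H}\,min}$, the set $C_a$ is a (possibly empty) union of generalized cylinders of $X_{\mathcal{G}}$; (ii) $\displaystyle\bigcup_{B\in\mathfrak{p}^0_{\mathcal{H}\,min}}C_B=X^0_{\mathcal{G}}$; (iii) if $(AAA\ldots)\in X_{\mathcal{G}}^0$ and $\Phi(AAA\ldots)=(BBB\ldots)\in X^0_{\mathcal{H}}$, then: (a) there exists a finite subset $F\subseteq\varepsilon(A)$ such that, for all $e\in\varepsilon(A)\setminus F$, if $x\in X_{\mathcal{G}}$ and $x_1=e$, then $(\Phi(x))_1=B$ or $(\Phi(x))_1\in\varepsilon(B)$, i.e., $\Phi(x)\in D_B$; (b) for all $x\in X_{\mathcal{G}}$ with $x_1\in\varepsilon(A)$ and $(\Phi(x))_1\in\varepsilon(B)$, the set $$A_x:=\{g\in\varepsilon(A):\ \text{there exists } y\in X_{\mathcal{G}}\text{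 with } y_1=g \text{ and } (\Phi(y))_1=(\Phi(x))_1\}$$ is finite.
   Context: An ultragraph is a quadruple $\mathcal{G}=(G^0,\mathcal{G}^1,r,s)$ with a set of vertices $G^0$, a set of edges $\mathcal{G}^1$, a source map $s:\mathcal{G}^1\to G^0$ and a range map $r:\mathcal{G}^1\to P(G^0)\setminus\{\emptyset\}$. It has no sinks if every vertex $v$ satisfies $s^{-1}(v)\neq\emptyset$. $\mathcal{G}^0$ is the smallest subset of $P(G^0)$ containing all $\{v\}$ ($v\in G^0$) and all $r(e)$ ($e\in\mathcal{G}^1$), closed under finite unions and under non-empty finite intersections. For $A\subseteq G^0$, $\varepsilon(A)=\{e\in\mathcal{G}^1: s(e)\in A\}$. $A\in\mathcal{G}^0$ is an infinite emitter if $\varepsilon(A)$ is infinite, and a minimal infinite emitter if moreover no proper subset of $A$ belonging to $\mathcal{G}^0$ is an infinite emitter. $\mathfrak{p}^0_{\mathcal{G}\,min}$ denotes the set of minimal infinite emitters. A finite path of length $n\geq1$ is $\alpha=\alpha_1\ldots\alpha_n$ with $\alpha_i\in\mathcal{G}^1$ and $s(\alpha_{i+1})\in r(\alpha_i)$ for $1\le i<n$; $r(\alpha)=r(\alpha_n)$. The ultrapath space $\mathfrak{p}_{\mathcal{G}}$ consists of the elements $A\in\mathcal{G}^0$ (length $0$, $r(A)=A$) and the pairs $(\alpha,A)$ with $\alpha$ a finite path of length $n\ge1$ and $A\in\mathcal{G}^0$, $A\subseteq r(\alpha)$ (length $n$, $r((\alpha,A))=A$). $X_{\mathcal{G}}^{inf}$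 is the set of infinite paths $(\gamma_i)_{i\ge1}$, $\gamma_i\in\mathcal{G}^1$, $s(\gamma_{i+1})\in r(\gamma_i)$ (length $\infty$). $X_{\mathcal{G}}^{fin}$ is the set of sequences $(\alpha_1\ldots\alpha_kAAA\ldots)$, $k\geq 0$, where $A$ is a minimal infinite emitter and, if $k\ge1$, $\alpha_1\ldots\alpha_k$ is a finite path with $A\subseteq r(\alpha_k)$; such a sequence has length $k$. $X_{\mathcal{G}}^0$ is the set of length-$0$ sequences $(AAA\ldots)$. The shift space is $X_{\mathcal{G}}=X_{\mathcal{G}}^{fin}\cup X_{\mathcal{G}}^{inf}$, with shift map $\sigma((x_i)_{i\ge1})=(x_{i+1})_{i\ge1}$; $|x|$ denotes the length of $x$. The alphabet is $\mathbf{A}_{\mathcal{G}}=\mathcal{G}^1\cup\mathfrak{p}^0_{\mathcal{G}\,min}$. The same notation is used for $\mathcal{H}$. An ultrapath $A\in\mathcal{G}^0$ is a prefix of $x\in X_{\mathcal{G}}$ if either $x_1\in\mathcal{G}^1$ and $s(x_1)\in A$, or $x_1$ is a minimal infinite emitter contained in $A$. An ultrapath $(\gamma_1\ldots\gamma_n,A)$ is a prefix of $x$ if $x_i=\gamma_i$ for $1\le i\le n$ and $A$ is a prefix of $\sigma^n(x)$. The topology on $X_{\mathcal{G}}$ is generated by the generalized cylinders $D_{\mathbf{y},F}=\{x\in X_{\mathcal{G}}:\mathbf{y}\text{ is a prefix of }x\text{ and }x_{|\mathbf{y}|+1}\notin F\}$, with $\mathbf{y}\in\mathfrak{p}_{\mathcal{G}}$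 and $F$ a finite (possibly empty) subset of $\varepsilon(r(\mathbf{y}))$; $D_{\mathbf{y}}=D_{\mathbf{y},\emptyset}$. A block of length $n\ge1$ in $X_{\mathcal{G}}$ is a word $a_1\ldots a_n\in(\mathbf{A}_{\mathcal{G}})^n$ occurring as $n$ consecutive entries of some $x\in X_{\mathcal{G}}$. A pseudo cylinder is the empty set or a set $[b]_k^\ell=\{x\in X_{\mathcal{G}}:(x_k\ldots x_\ell)=b\}$ with $1\le k\le\ell$ and $b$ a block. A set $C\subseteq X_{\mathcal{G}}$ is finitely defined if both $C$ and its complement $C^c$ are unions (of arbitrary families) of pseudo cylinders. A map $\Phi:X_{\mathcal{G}}\to X_{\mathcal{H}}$ is shift commuting if $\Phi\circ\sigma=\sigma\circ\Phi$. It is a generalized sliding block code if $(\Phi(x))_n=\sum_{a\in\mathbf{A}_{\mathcal{H}}}a\mathbf{1}_{C_a}\circ\sigma^{n-1}(x)$ for all $x\in X_{\mathcal{G}}$, $n\ge1$, where $\{C_a\}_{a\in\mathbf{A}_{\mathcal{H}}}$ is a partition of $X_{\mathcal{G}}$ by finitely defined sets. Here a partition is a family of pairwise disjoint (possibly empty) sets with union $X_{\mathcal{G}}$, and the sum is symbolic: $(\Phi(x))_n=a$ for the unique $a$ with $\sigma^{n-1}(x)\in C_a$. *)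

(* Defs.v *)
From HB Require Import structures.
From mathcomp Require Import all_boot.
From mathcomp Require Import boolp classical_sets functions cardinality topology.

Set Implicit Arguments.
Unset Strict Implicit.
Unset Printing Implicit Defensive.

Local Open Scope classical_set_scope.

Record ultragraph := Ultragraph {
  vertex : Type;
  edge : Type;
  src : edge -> vertex;
  rng : edge -> set vertex;
  rng_neq0 : forall e, rng e !=set0
}.

Definition no_sinks (G : ultragraph) : Prop :=
  forall v : vertex G, exists e : edge G, src e = v.

Section Ultragraph.
Variable G : ultragraph.
Implicit Types (A B : set (vertex G)) (e f g : edge G) (alpha : seq (edge G)).

(* Closure "under non-empty finite intersections" is read as closure under
   those intersections that are non-empty sets. *)
Definition ultra_closed (M : set (set (vertex G))) : Prop :=
  (forall A B, M A -> M B -> M (A `|` B)) /\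
  (forall A B, M A -> M B -> A `&` B !=set0 -> M (A `&` B)).

Definition gen_vertices : set (set (vertex G)) :=
  smallest ultra_closed
    ([set [set v] | v in [set: vertex G]] `|` [set rng e | e in [set: edge G]]).

Definition emitted A : set (edge G) := [set e | A (src e)].

Definition infinite_emitter A : Prop :=
  gen_vertices A /\ infinite_set (emitted A).

Definition min_infinite_emitters : set (set (vertex G)) :=
  [set A | infinite_emitter A /\
           forall B, B `<` A -> gen_vertices B -> ~ infinite_emitter B].

Definition min_emitter : Type := set_type min_infinite_emitters.

Definition alphabet : Type := (edge G + min_emitter)%type.

Definition is_path alpha : Prop :=
  sorted (fun e f => src f \in rng e) alpha.

(* The range of the last edge; for the empty path it is the whole vertex set,
   so that [A `<=` path_range [::]] puts no constraint on [A]. *)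
Definition path_range alpha : set (vertex G) := last setT (map (@rng G) alpha).

(* Sequences (x_i)_{i >= 1} are indexed from 0: [x i] stands for x_{i+1}. *)
Definition inf_seqs : set (nat -> alphabet) :=
  [set x | exists gamma : nat -> edge G,
     (forall i, rng (gamma i) (src (gamma i.+1))) /\
     x = (fun i => inl (gamma i))].

Definition fin_seqs_of_length (k : nat) : set (nat -> alphabet) :=
  [set x | exists alpha (A : min_emitter),
     [/\ size alpha = k, is_path alpha, val A `<=` path_range alpha &
         x = nth (inr A) (map inl alpha)]].

Definition fin_seqs : set (nat -> alphabet) :=
  [set x | exists k, fin_seqs_of_length k x].

Record shift_space := ShiftSpace {
  shift_seq :> nat -> alphabet;
  shift_seqP : (fin_seqs `|` inf_seqs) shift_seq
}.

Implicit Types (x y : shift_space).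

Lemma shift_seq_subproof x :
  (fin_seqs `|` inf_seqs) (fun i => x i.+1).
Proof.
case: x => x /= [[k [alpha [A [_ pa sA ->]]]]|[gamma [pg ->]]].
- left; exists (size (behead alpha)), (behead alpha), A; split => //.
  + by case: alpha pa {sA} => //= e s; apply: path_sorted.
  + by case: alpha pa sA => [|e [|f s]] _ //= _ ? _.
  + by apply/funext => i; case: alpha {pa sA} => [|e s] //=; rewrite !nth_nil.
- by right; exists (fun i => gamma i.+1); split => // i; apply: pg.
Qed.

Definition shift x : shift_space := ShiftSpace (shift_seq_subproof x).

Lemma const_seq_subproof (A : min_emitter) :
  (fin_seqs `|` inf_seqs) (fun=> inr A).
Proof.
left; exists 0%N, [::], A; split => //.
by apply/funext => i; rewrite nth_nil.
Qed.

Definition const_point (A : min_emitter) : shift_space :=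
  ShiftSpace (const_seq_subproof A).

(* [None] is the infinite length. *)
Definition seq_length x : option nat :=
  xget None [set Some k | k in [set k | fin_seqs_of_length k x]].

Definition shift_space0 : set shift_space := [set x | seq_length x = Some 0%N].

Lemma fin_seqs_of_length_inj k l x :
  fin_seqs_of_length k x -> fin_seqs_of_length l x -> k = l.
Proof.
have half m n : fin_seqs_of_length m x -> fin_seqs_of_length n x -> (m <= n)%N.
  move=> [a [A [<- _ _ xa]]] [b [B [<- _ _]]]; rewrite xa leqNgt => /funeqP ab.
  apply/negP => ltba; have := ab (size b).
  case: a ltba {xa ab} => // e s ltba.
  by rewrite (nth_map e) // [RHS]nth_default // size_map.
by move=> xk xl; apply/eqP; rewrite eqn_leq !half.
Qed.

Lemma seq_lengthP k x : seq_length x = Some k <-> fin_seqs_of_length k x.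
Proof.
rewrite /seq_length; split.
  by case: xgetP => [_ -> [l xl <-] [<-]|//].
move=> xk; case: xgetP => [_ -> [l xl <-]|/(_ (Some k))[]].
  by rewrite (fin_seqs_of_length_inj xk xl).
by exists k.
Qed.

Lemma seq_length_infP x : seq_length x = None <-> inf_seqs x.
Proof.
split=> [xN|[gamma [_ xg]]].
  case: (shift_seqP x) => // -[k /seq_lengthP].
  by rewrite xN.
case E: (seq_length x) => [k|//]; move/seq_lengthP: E.
move=> [a [A [_ _ _]]]; rewrite xg => /funeqP/(_ (size a)).
by rewrite [RHS]nth_default // size_map.
Qed.

(* A pair [(alpha, A)] encodes the ultrapath [(alpha, A)]; the pair [([::], A)]
   encodes the ultrapath [A] of length 0. *)
Definition is_ultrapath (p : seq (edge G) * set (vertex G)) : Prop :=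
  [/\ is_path p.1, gen_vertices p.2 & p.2 `<=` path_range p.1].

Definition vertex_prefix A x : Prop :=
  match x 0%N with
  | inl e => A (src e)
  | inr B => val B `<=` A
  end.

Definition is_prefix (p : seq (edge G) * set (vertex G)) x : Prop :=
  mkseq x (size p.1) = map inl p.1 /\
  vertex_prefix p.2 (iter (size p.1) shift x).

Definition cylinder (p : seq (edge G) * set (vertex G)) (F : set (edge G)) :
    set shift_space :=
  [set x | is_prefix p x /\ ~ (exists2 e, F e & x (size p.1) = inl e)].

Definition gen_cylinders : set (set shift_space) :=
  [set D | exists p F, [/\ is_ultrapath p, finite_set F,
                           F `<=` emitted p.2 & D = cylinder p F]].

Definition is_union_of (S : set (set shift_space)) (C : set shift_space) :
    Prop :=
  exists2 P : set (set shift_space), P `<=` S & C = \bigcup_(D in P) D.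

Definition word (x : shift_space) (k l : nat) : seq alphabet :=
  [seq x i | i <- index_iota k l.+1].

Definition is_block (b : seq alphabet) : Prop :=
  exists (x : shift_space) k l, (k <= l)%N /\ b = word x k l.

Definition pseudo_cylinders : set (set shift_space) :=
  [set C | C = set0 \/
     exists k l b, [/\ (k <= l)%N, is_block b & C = [set x | word x k l = b]]].

Definition finitely_defined (C : set shift_space) : Prop :=
  is_union_of pseudo_cylinders C /\ is_union_of pseudo_cylinders (~` C).

End Ultragraph.

HB.instance Definition _ (G : ultragraph) := gen_eqMixin (shift_space G).
HB.instance Definition _ (G : ultragraph) := gen_choiceMixin (shift_space G).
HB.instance Definition _ (G : ultragraph) :=
  isSubBaseTopological.Build (shift_space G) (@gen_cylinders G) id.

Section Maps.
Variables G H : ultragraph.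
Implicit Types (Phi : shift_space G -> shift_space H)
               (C : alphabet H -> set (shift_space G)).

Definition shift_commuting Phi : Prop :=
  forall x, Phi (shift x) = shift (Phi x).

Definition length_preserving Phi : Prop :=
  forall x, seq_length (Phi x) = seq_length x.

Definition finitely_defined_partition C : Prop :=
  [/\ trivIset setT C, \bigcup_a C a = setT & forall a, finitely_defined (C a)].

(* The symbolic sum [\sum_a a 1_{C_a}(sigma^n(x))] is the unique letter [a]
   such that [sigma^n(x)] belongs to [C_a]. *)
Definition sliding_block_code_given_by Phi C : Prop :=
  finitely_defined_partition C /\
  forall x n a, C a (iter n (@shift G) x) <-> Phi x n = a.

Definition edge_condition C : Prop :=
  forall e : edge H, is_union_of (@gen_cylinders G) (C (inl e)).

Definition emitter_condition C : Prop :=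
  \bigcup_(B in [set: min_emitter H]) C (inr B) = @shift_space0 G.

Definition local_image_condition Phi (A : min_emitter G) (B : min_emitter H) :
    Prop :=
  exists F : set (edge G),
    [/\ finite_set F, F `<=` emitted (val A) &
        forall e, (emitted (val A) `\` F) e ->
        forall x : shift_space G, x 0%N = inl e ->
          Phi x 0%N = inr B \/
          exists2 f, emitted (val B) f & Phi x 0%N = inl f].

Definition finite_fibre_condition Phi (A : min_emitter G) (B : min_emitter H) :
    Prop :=
  forall x : shift_space G,
    (exists2 e, emitted (val A) e & x 0%N = inl e) ->
    (exists2 f, emitted (val B) f & Phi x 0%N = inl f) ->
    finite_set [set g | emitted (val A) g /\
      exists2 y : shift_space G, y 0%N = inl g & Phi y 0%N = Phi x 0%N].

End Maps.

(* Main.v *)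
Require Import Defs.
From mathcomp Require Import all_boot.
From mathcomp Require Import boolp classical_sets functions cardinality topology.

(* A point x has the basis of neighbourhoods that copy its edges x_1 ... x_m and
   then, if x_{m+1} is an edge, copy it too; if x_{m+1} is a minimal infinite
   emitter A, any edge of A outside a finite set F is also allowed.  Minimality
   of A is what excludes the other infinite emitters contained in A.

   A shift commuting Phi is determined by x |-> Phi(x)_1, and C_a is the fibre
   of that map over a.  The iterate sigma^n is continuous at every x of length at
   least n, so for a length preserving Phi continuity reduces to controlling
   Phi(y)_1 for y near x.  If Phi(x)_1 is an edge, this is openness of its fibre.
   Otherwise x = (AAA...) and Phi(x) = (BBB...), and conditions (a) and (b) are
   continuity at that point: (a) for the neighbourhood D_B, (b) for D_{B,{f}}. *)

Set Implicit Arguments.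
Unset Strict Implicit.
Unset Printing Implicit Defensive.

Local Open Scope classical_set_scope.

Lemma eq_mkseqP (T : Type) (f g : nat -> T) n :
  mkseq f n = mkseq g n <-> forall i, i < n -> f i = g i.
Proof.
split=> [fg i ltin|fg].
  by rewrite -(nth_mkseq (f i) f ltin) fg nth_mkseq.
by apply/eq_in_map => i; rewrite mem_iota => /fg.
Qed.

(** * Letters, words and lengths of points of the shift space *)

Section Sequences.
Variable G : ultragraph.
Implicit Types (x y : shift_space G) (e : edge G) (alpha : seq (edge G)).
Implicit Types (A B : min_emitter G).

Lemma shift_seq_inj x y : x =1 y -> x = y.
Proof.
case: x y => x xP [y yP] /= /funext xy.
by case: y / xy yP => yP; congr ShiftSpace; apply: Prop_irrelevance.
Qed.

Lemma iter_shiftE n x i : iter n (@shift G) x i = x (n + i).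
Proof. by elim: n i => //= n IHn i; rewrite IHn addnS. Qed.

(** Inside a path this is the path condition. After the last edge of a finite-length point it is the
    inclusion of the final emitter in the range of that edge; [vertex_prefix] covers both cases. *)
Lemma next_letter x i e : x i = inl e ->
  vertex_prefix (rng e) (iter i.+1 (@shift G) x).
Proof.
rewrite /vertex_prefix iter_shiftE addn0.
case: x => x /= [[k [alpha [A [_ pa sA ->]]]]|[gamma [pg ->]]]; last first.
  by case=> <-.
have [ltia|leai] := ltnP i (size alpha); last first.
  by rewrite nth_default ?size_map.
rewrite (nth_map e) // => -[ie].
have [lti1a|lea] := ltnP i.+1 (size alpha).
  rewrite (nth_map e) //; move/(sortedP e): pa => /(_ _ lti1a).
  by rewrite ie inE.
rewrite nth_default ?size_map //.
have sa : size alpha = i.+1 by apply/eqP; rewrite eqn_leq lea.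
by move: sA; rewrite /path_range -nth_last size_map sa /= (nth_map e) ?sa ?ie.
Qed.

Lemma iter_shift_const x i A : x i = inr A ->
  iter i (@shift G) x = const_point A.
Proof.
move=> xi; apply: shift_seq_inj => j; rewrite iter_shiftE /=.
case: x xi => x /= [[k [alpha [B [_ _ _ ->]]]]|[gamma [_ ->]]] //.
have [ltia|leai] := ltnP i (size alpha).
  by move=> xi; move: (ltia) xi; case: (alpha) => // e s lt; rewrite (nth_map e).
by rewrite !nth_default ?size_map // (leq_trans leai) // leq_addr.
Qed.

Lemma shift_space_const x A : x 0 = inr A -> x = const_point A.
Proof. exact: iter_shift_const. Qed.

(** This is the inequality m <= |x|, with infinite length allowed. *)
Definition edges_before x m := forall i, i < m -> is_inl (x i).

Lemma edges_before_word x m : edges_before x m ->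
  exists2 alpha, size alpha = m & mkseq x m = map inl alpha.
Proof.
elim: m => [_|m IHm xm]; first by exists [::].
have [i lim|alpha sa xa] := IHm; first by apply: xm; apply: ltnW.
have := xm m (ltnSn m); case xmE: (x m) => [e|//] _.
exists (rcons alpha e); first by rewrite size_rcons sa.
by rewrite mkseqS xa map_rcons xmE.
Qed.

Lemma path_range_rcons alpha e : path_range (rcons alpha e) = rng e.
Proof. by rewrite /path_range map_rcons last_rcons. Qed.

Lemma word_is_path x alpha :
  mkseq x (size alpha) = map inl alpha -> is_path alpha.
Proof.
case: alpha => // e0 s; set alpha := e0 :: s => xa.
have xE i : i < size alpha -> x i = inl (nth e0 alpha i).
  by move=> lti; rewrite -(nth_mkseq (inl e0) x lti) xa (nth_map e0).
apply/(sortedP e0) => i lti; rewrite inE.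
have := next_letter (xE _ (ltnW lti)).
by rewrite /vertex_prefix iter_shiftE addn0 xE.
Qed.

Lemma word_path_range x alpha :
  mkseq x (size alpha) = map inl alpha ->
  vertex_prefix (path_range alpha) (iter (size alpha) (@shift G) x).
Proof.
elim/last_ind: alpha => [|alpha e _]; first by rewrite /vertex_prefix; case: (_ 0).
rewrite size_rcons mkseqS map_rcons path_range_rcons.
by move=> /rcons_inj[_ xe]; apply: next_letter.
Qed.

(** Any word of edges read at the start of a point is already a path with the right range, and the
    tail after an emitter is constant. Hence the length depends only on which letters are edges. *)
Lemma seq_length_SomeP x k :
  seq_length x = Some k <-> edges_before x k /\ ~~ is_inl (x k).
Proof.
rewrite seq_lengthP; split=> [[alpha [A [<- _ _ xE]]]|[xk]].
  split=> [i lti|]; rewrite xE; last by rewrite nth_default ?size_map.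
  by case: (alpha) lti => // e s lti; rewrite (nth_map e).
case xkE: (x k) => [//|A] _.
have [alpha sa xa] := edges_before_word xk; rewrite -{1}sa in xa.
exists alpha, A; split => //; first exact: word_is_path xa.
  have := word_path_range xa.
  by rewrite /vertex_prefix iter_shiftE addn0 sa xkE.
apply/funext => i; have [ltik|leki] := ltnP i (size alpha).
  by rewrite -xa nth_mkseq.
rewrite nth_default ?size_map // -(subnKC leki) -iter_shiftE sa.
by rewrite (iter_shift_const xkE).
Qed.

Lemma shift_space0P x : shift_space0 x <-> exists A, x 0 = inr A.
Proof.
rewrite /shift_space0/= seq_length_SomeP; split=> [[_]|[A ->]] //.
by case: (x 0) => // A _; exists A.
Qed.

End Sequences.

Lemma eq_seq_length (G H : ultragraph) (x : shift_space G) (y : shift_space H) :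
  (forall i, is_inl (x i) = is_inl (y i)) -> seq_length x = seq_length y.
Proof.
move=> xy; have lenE k : seq_length x = Some k <-> seq_length y = Some k.
  rewrite !seq_length_SomeP /edges_before xy.
  by split=> -[ek nk]; split=> // i /ek; rewrite xy.
case Ex: (seq_length x) => [k|]; first by symmetry; apply/lenE.
by case Ey: (seq_length y) => [k|//]; move/lenE: Ey; rewrite Ex.
Qed.

(** * Neighbourhood bases, cylinders and pseudo cylinders *)

Section Topology.
Variable G : ultragraph.
Implicit Types (x y : shift_space G) (e : edge G) (F : set (edge G)).
Implicit Types (A B : min_emitter G) (U D : set (shift_space G)).

Lemma min_emitterP A : min_infinite_emitters (val A).
Proof. by have := valP A; rewrite inE. Qed.

Lemma min_emitter_gen A : gen_vertices (val A).
Proof. by have [[]] := min_emitterP A. Qed.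

Lemma min_emitter_sub A B : val B `<=` val A -> B = A.
Proof.
move=> BA; apply/val_inj; apply: contrapT => neq.
have [_ /(_ (val B))] := min_emitterP A.
apply; [split=> // AB|exact: min_emitter_gen|by have [] := min_emitterP B].
by apply: neq; apply/seteqP.
Qed.

Definition near_letter F (a b : alphabet G) : Prop :=
  match a with
  | inl _ => b = a
  | inr A => b = inr A \/ exists2 e, (emitted (val A) `\` F) e & b = inl e
  end.

Definition basic_nbhs x m F : set (shift_space G) :=
  [set y | (forall i, i < m -> y i = x i) /\ near_letter F (x m) (y m)].

Lemma near_letter_refl F a : near_letter F a a.
Proof. by case: a => //= A; left. Qed.

(** If the letter of x after the word of p is an emitter A, then A lies in [p.2], so any edge of A
    outside [F] may replace it without leaving the cylinder. *)
Lemma cylinder_basic_nbhs p F x : cylinder p F x ->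
  edges_before x (size p.1) /\ basic_nbhs x (size p.1) F `<=` cylinder p F.
Proof.
move=> [[xp vx] xF]; split=> [i lti|y [yx]].
  case: (p.1) lti xp => // e s lti xp.
  by rewrite -(nth_mkseq (inl e) x lti) xp (nth_map e).
have {}xp : mkseq y (size p.1) = map inl p.1 by rewrite -xp; apply/eq_mkseqP.
move: vx xF; rewrite /cylinder/= /is_prefix /vertex_prefix !iter_shiftE !addn0.
case: (x _) => [e|A] /= vx xF; first by move=> ->.
move=> [->|[e [Ae Fe] ->]]; first by split=> // -[].
by split=> [|[f Ff [ef]]]; [split=> //; apply: vx|apply: Fe; rewrite ef].
Qed.

Lemma basic_nbhs_cylinder x m F : edges_before x m -> finite_set F ->
  exists D, [/\ gen_cylinders D, D x & D `<=` basic_nbhs x m F].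
Proof.
move=> /edges_before_word[alpha sa xa] finF.
case xm: (x m) => [e|A].
  (* The next letter is an edge e: the full range of e as final set leaves the continuation free. *)
  have xae : mkseq x (size (rcons alpha e)) = map inl (rcons alpha e).
    by rewrite size_rcons sa mkseqS xa map_rcons xm.
  exists (cylinder (rcons alpha e, rng e) set0); split.
  - exists (rcons alpha e, rng e), set0; split=> //.
    split=> /=; first exact: word_is_path xae.
    + by apply: sub_gen_smallest; right; exists e.
    + by rewrite path_range_rcons.
  - split; last by case.
    split=> //=; rewrite -(path_range_rcons alpha); exact: word_path_range.
  - move=> y [[/= ya _] _].
    have {}ya i : i < m.+1 -> y i = x i.
      by move: i; apply/eq_mkseqP; rewrite -sa -(size_rcons alpha e) ya.
    by split=> [i /ltnW/ya //|]; rewrite ya //; apply: near_letter_refl.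
rewrite -sa in xa xm *.
have vE y : iter (size alpha) (@shift G) y 0 = y (size alpha).
  by rewrite iter_shiftE addn0.
(* The next letter is an emitter A: [F] is cut down to the edges of A, as a generalized cylinder
   requires. *)
exists (cylinder (alpha, val A) (F `&` emitted (val A))); split.
- exists (alpha, val A), (F `&` emitted (val A)); split=> //.
  + split=> /=; [exact: word_is_path xa|exact: min_emitter_gen|].
    by have := word_path_range xa; rewrite /vertex_prefix vE xm.
  + exact: sub_finite_set finF.
- by split=> /=; [split=> //; rewrite /vertex_prefix vE xm|rewrite xm => -[]].
move=> y [[/= ya vy] Fy]; split; first by apply/eq_mkseqP; rewrite xa.
rewrite xm; move: vy Fy; rewrite /vertex_prefix vE.
case: (y _) => [e Ae Fy|B /min_emitter_sub -> _]; last by left.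
by right; exists e => //; split=> // Fe; apply: Fy; exists e.
Qed.

Lemma basic_nbhsS x m m' F F' :
  m < m' -> edges_before x m' ->
  basic_nbhs x m' F' `<=` basic_nbhs x m F.
Proof.
move=> ltm xm' y [yx _]; split=> [i ltim|].
  by apply: yx; apply: ltn_trans ltm.
by rewrite yx //; apply: near_letter_refl.
Qed.

Lemma basic_nbhsSF x m F F' : F `<=` F' ->
  basic_nbhs x m F' `<=` basic_nbhs x m F.
Proof.
move=> FF' y [yx yn]; split=> //; move: yn; rewrite /near_letter.
case: (x m) => // A [->|[e [Ae F'e] ->]]; first by left.
by right; exists e => //; split=> // /FF'.
Qed.

Lemma gen_cylinder_open D : gen_cylinders D -> open D.
Proof.
move=> gD; exists [set D]; last by rewrite bigcup_set1.
by move=> _ ->; apply: (@finI_from1 _ _ _ id).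
Qed.

Definition basic_filter x : set_system (shift_space G) :=
  [set U | exists m F,
    [/\ edges_before x m, finite_set F & basic_nbhs x m F `<=` U]].

(** Of two basic neighbourhoods at different positions, the one further along is contained in the
    other whatever the finite sets; at equal positions the union of the finite sets works. *)
Lemma basic_filterP x : Filter (basic_filter x).
Proof.
split=> [|P Q [m [F [xm finF sP]]] [n [E [xn finE sQ]]]|P Q PQ [m [F [? ? sP]]]].
- by exists 0, set0; split.
- have [ltmn|ltnm|mn] := ltngtP m n.
  + exists n, E; split=> // y yE; split; last exact: sQ.
    exact/sP/basic_nbhsS/yE.
  + exists m, F; split=> // y yF; split; first exact: sP.
    exact/sQ/basic_nbhsS/yF.
  + rewrite -{n}mn in xn sQ *.
    exists m, (F `|` E); split=> //; first by rewrite finite_setU.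
    by move=> y yFE; split; [apply: sP|apply: sQ];
      apply: basic_nbhsSF yFE => e; [left|right].
- by exists m, F; split=> //; apply: subset_trans PQ.
Qed.

(** Cylinders are given only as a subbase. The filter property absorbs finite intersections, so one
    cylinder at a time has to be compared with the basic neighbourhoods. *)
Lemma nbhs_basicE x : nbhs x = basic_filter x.
Proof.
apply/seteqP; split=> U; last first.
  move=> [m [F [xm finF sU]]].
  have [D [gD Dx sD]] := basic_nbhs_cylinder xm finF.
  rewrite nbhsE; exists D; last exact: subset_trans sU.
  by split=> //; apply: gen_cylinder_open.
rewrite nbhsE => -[V [[S sS <-] [W SW Wx]] sU].
have fx := basic_filterP x.
have [E sE WE] := sS _ SW.
apply: (@filterS _ _ _ W) => [y Wy|]; first by apply: sU; exists W.
rewrite -WE; apply: filter_bigI => D DE.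
have := sE _ DE; rewrite inE => -[p [F [_ finF _ D_def]]].
have : D x by move: Wx; rewrite -WE; apply.
rewrite D_def => /cylinder_basic_nbhs[xp sF].
by exists (size p.1), F; split.
Qed.

Lemma open_union_of_cylinders U : open U -> is_union_of (@gen_cylinders G) U.
Proof.
rewrite openE => oU; exists [set D | gen_cylinders D /\ D `<=` U].
  by move=> D [].
apply/seteqP; split=> [x /oU|x [D [_ DU] /DU//]].
rewrite /interior nbhs_basicE => -[m [F [xm finF sU]]].
have [D [gD Dx sD]] := basic_nbhs_cylinder xm finF.
by exists D => //; split=> //; apply: subset_trans sU.
Qed.

Lemma union_of_cylinders_open U : is_union_of (@gen_cylinders G) U -> open U.
Proof. by move=> [P sP ->]; apply: bigcup_open => D /sP/gen_cylinder_open. Qed.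

Lemma iter_shift_continuous_at n x : edges_before x n ->
  continuous_at x (iter n (@shift G)).
Proof.
move=> xn U Unbhs; suff : nbhs x (iter n (@shift G) @^-1` U) by [].
have : nbhs (iter n (@shift G) x) U by []; rewrite !nbhs_basicE.
move=> [m [F [xnm finF sU]]]; exists (n + m), F; split=> // [i|y [yx yn]].
  have [/xn//|leni] := ltnP i n.
  by rewrite -{1}(subnKC leni) ltn_add2l => /xnm; rewrite iter_shiftE subnKC.
apply: sU; split=> [i ltim|]; rewrite !iter_shiftE //.
by rewrite yx // ltn_add2l.
Qed.

Lemma word_local_pseudo_union U :
  (forall x, U x -> exists n, forall y, word y 0 n = word x 0 n -> U y) ->
  is_union_of (@pseudo_cylinders G) U.
Proof.
move=> locU; exists [set D | pseudo_cylinders D /\ D `<=` U].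
  by move=> D [].
apply/seteqP; split=> [x Ux|x [D [_ DU] /DU//]].
have [n nU] := locU _ Ux; exists [set y | word y 0 n = word x 0 n] => //.
split=> //; right; exists 0, n, (word x 0 n); split=> //.
by exists x, 0, n.
Qed.

Lemma wordP x y n : word y 0 n = word x 0 n <-> forall i, i <= n -> y i = x i.
Proof. by rewrite /word /index_iota subn0; apply: (eq_mkseqP _ _ n.+1). Qed.

(** The topology is coarser than the product of discrete topologies: copying x up to and including
    position m stays in the basic neighbourhood, whatever the finite set. *)
Lemma nbhs_word x U : nbhs x U ->
  exists n, forall y, word y 0 n = word x 0 n -> U y.
Proof.
rewrite nbhs_basicE => -[m [F [_ _ sU]]]; exists m => y /wordP yx.
apply: sU; split=> [i /ltnW/yx //|]; rewrite yx //; exact: near_letter_refl.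
Qed.

End Topology.

(** * Shift commuting maps and their first letter *)

Section Maps.
Variables (G H : ultragraph) (Phi : shift_space G -> shift_space H).

Hypothesis Phi_shift : shift_commuting Phi.

Lemma iter_shift_commuting n x :
  Phi (iter n (@shift G) x) = iter n (@shift H) (Phi x).
Proof. by elim: n => //= n IHn; rewrite Phi_shift IHn. Qed.

Lemma first_letter n x : Phi (iter n (@shift G) x) 0 = Phi x n.
Proof. by rewrite iter_shift_commuting iter_shiftE addn0. Qed.

Lemma length_preserving_first : length_preserving Phi ->
  forall x, is_inl (Phi x 0) = is_inl (x 0).
Proof.
move=> Phi_len x; have := Phi_len x.
case xE: (x 0) => [e|A]; case yE: (Phi x 0) => [f|B] //= lenE.
- have /seq_length_SomeP[_] : seq_length x = Some 0.
    by rewrite -lenE; apply/seq_length_SomeP; rewrite yE.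
  by rewrite xE.
- have /seq_length_SomeP[_] : seq_length (Phi x) = Some 0.
    by rewrite lenE; apply/seq_length_SomeP; rewrite xE.
  by rewrite yE.
Qed.

Lemma first_length_preserving :
  (forall x, is_inl (Phi x 0) = is_inl (x 0)) -> length_preserving Phi.
Proof.
move=> Phi_inl x; apply: eq_seq_length => i.
by rewrite -first_letter Phi_inl iter_shiftE addn0.
Qed.

(** A basic neighbourhood of [Phi x] constrains finitely many positions i <= |Phi x| = |x|. Letter i
    of [Phi y] is the first letter of the image of the i-th shift of y, and that shift is continuous
    at x. *)
Lemma continuous_near_letter :
  (forall x F, finite_set F ->
     nbhs x [set y | near_letter F (Phi x 0) (Phi y 0)]) ->
  length_preserving Phi -> continuous Phi.
Proof.
move=> near0 /length_preserving_first Phi_inl x U Unbhs.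
have : nbhs (Phi x) U by []; rewrite nbhs_basicE => -[m [F [xm finF sU]]].
suff : nbhs x (Phi @^-1` U) by [].
have near_i E i : finite_set E -> edges_before (Phi x) i ->
    nbhs x [set y | near_letter E (Phi x i) (Phi y i)].
  move=> finE xi.
  have xi' : edges_before x i.
    by move=> j /xi; rewrite -first_letter Phi_inl iter_shiftE addn0.
  have : nbhs x (iter i (@shift G) @^-1`
      [set y | near_letter E (Phi (iter i (@shift G) x) 0) (Phi y 0)]).
    exact: iter_shift_continuous_at xi' _ (near0 _ _ finE).
  by apply: filterS => y /=; rewrite !first_letter.
have near_m : nbhs x [set y | forall i : 'I_m, Phi y i = Phi x i].
  apply: (@filter_forall _ 'I_m (fun i => [set y | Phi y i = Phi x i]) _
    (nbhs_filter x)) => i.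
  have ei : edges_before (Phi x) i.
    by move=> j ltji; apply: xm; apply: ltn_trans (ltn_ord i).
  (* Before position m the letters of [Phi x] are edges, for which nearness is equality. *)
  have := near_i set0 i (@finite_set0 _) ei; have := xm i (ltn_ord i).
  by case: (Phi x i).
apply: filterS (filterI near_m (near_i _ _ finF xm)) => y [ym yn].
by apply: sU; split=> // i ltim; apply: (ym (Ordinal ltim)).
Qed.

End Maps.

Lemma continuous_first_edge_open G H (Phi : shift_space G -> shift_space H) f :
  continuous Phi -> open [set x | Phi x 0 = inl f].
Proof.
move=> Phi_cont.
have -> : [set x | Phi x 0 = inl f] = Phi @^-1` [set y | y 0 = inl f] by [].
move/continuousP: Phi_cont; apply; rewrite openE => y /= yf.
rewrite /interior nbhs_basicE; exists 0, set0; split=> // z [_].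
by rewrite yf.
Qed.

Lemma continuous_sliding_block_code G H (Phi : shift_space G -> shift_space H) :
  continuous Phi -> shift_commuting Phi -> length_preserving Phi ->
  sliding_block_code_given_by Phi (fun a => [set x | Phi x 0 = a]).
Proof.
move=> Phi_cont Phi_shift /length_preserving_first Phi_inl.
have loc x : exists n, forall y, word y 0 n = word x 0 n -> Phi y 0 = Phi x 0.
  case Ex: (Phi x 0) => [f|B].
    apply: nbhs_word; apply: open_nbhs_nbhs; split=> //.
    exact: continuous_first_edge_open.
  (* Here x must be constant, hence determined by its first letter; n = 0 works because [word x 0 0]
     has one letter. *)
  have : ~~ is_inl (x 0) by rewrite -Phi_inl // Ex.
  case xE: (x 0) => [//|A] _; exists 0 => y /wordP/(_ 0 isT); rewrite xE.
  by rewrite -Ex (shift_space_const xE) => /shift_space_const ->.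
split=> [|x n a] /=; last by rewrite first_letter.
split=> [a b _ _ [x [<- <-//]]||a].
  by apply/seteqP; split=> // x _; exists (Phi x 0).
by split; apply: word_local_pseudo_union => x /= xa;
  have [n nx] := loc x; exists n => y /nx ->.
Qed.

Lemma sliding_block_code_commuting G H (Phi : shift_space G -> shift_space H) C :
  sliding_block_code_given_by Phi C -> shift_commuting Phi.
Proof.
move=> [_ PhiC] x; apply: shift_seq_inj => n /=.
by apply/PhiC; rewrite -iterSr; apply/PhiC.
Qed.

(** * Continuity at constant points and conditions (a) and (b) *)

Section Const.
Variables (G H : ultragraph) (Phi : shift_space G -> shift_space H).
Variables (A : min_emitter G) (B : min_emitter H).
Hypothesis PhiAB : Phi (const_point A) = const_point B.

Lemma near_const_point F : finite_set F ->
  continuous Phi -> exists2 E, finite_set E &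
  forall (x : shift_space G) e, x 0 = inl e -> (emitted (val A) `\` E) e ->
    near_letter F (inr B) (Phi x 0).
Proof.
move=> finF /(_ (const_point A)) Phi_at.
have : nbhs (const_point A) [set x | near_letter F (inr B) (Phi x 0)].
  apply: (Phi_at [set y | near_letter F (inr B) (y 0)]); rewrite PhiAB.
  suff : nbhs (const_point B) [set y | near_letter F (inr B) (y 0)] by [].
  by rewrite nbhs_basicE; exists 0, F; split=> // y [].
rewrite nbhs_basicE => -[m [E [Am finE sE]]]; exists E => // x e xe AEe.
(* The constant point has length 0, so its basic neighbourhoods exist only at position 0. *)
apply: sE; case: m Am => [_|m /(_ 0 isT)//]; split=> //.
by right; exists e.
Qed.

Lemma continuous_local_image : continuous Phi -> local_image_condition Phi A B.
Proof.
move=> /(near_const_point (@finite_set0 (edge H)))[E finE nearE].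
exists (E `&` emitted (val A)); split=> [||e [Ae nEe] x xe].
- exact: sub_finite_set finE.
- by [].
case: (nearE x e xe); [by split=> // Ee; apply: nEe|by left|].
by move=> [f [Bf _] ->]; right; exists f.
Qed.

Lemma continuous_finite_fibre : continuous Phi -> finite_fibre_condition Phi A B.
Proof.
move=> Phi_cont x _ [f _ xf].
(* With f itself excluded on the image side, no edge of A outside [E] can start a point whose image
   starts with f; so the fibre lies in [E]. *)
have [E finE nearE] := near_const_point (finite_set1 f) Phi_cont.
apply: sub_finite_set finE => g [Ag [y yg]]; rewrite xf => yf.
apply: contrapT => nEg; have [//||] := nearE y g yg; rewrite yf //.
by move=> [h [_ nhf] [fh]]; apply: nhf.
Qed.

(* Finitely many edges are removed from [A]: the exceptional set [E] of the
   local image condition, and the fibre over each letter of [F]. *)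
Lemma near_const_letter F : finite_set F ->
  local_image_condition Phi A B -> finite_fibre_condition Phi A B ->
  nbhs (const_point A) [set y | near_letter F (inr B) (Phi y 0)].
Proof.
move=> finF [E [finE _ imgE]] fibE.
pose fib f := [set g | emitted (val A) g /\
  exists2 y : shift_space G, y 0 = inl g & Phi y 0 = inl f].
rewrite nbhs_basicE.
exists 0, (E `|` \bigcup_(f in F `&` emitted (val B)) fib f).
split=> // [|y [_ /= [y0|[e [Ae nEe] ye]]]].
- rewrite finite_setU; split=> //; apply: bigcup_finite => [|f [_ Bf]].
    exact: sub_finite_set finF.
  (* Condition (b) needs a point realising f. If there is one, the fibre is its set of edges;
     otherwise the fibre is empty. *)
  have [[x [[e Ae xe] xf]]|nfib] := pselect (exists x : shift_space G,
      (exists2 e, emitted (val A) e & x 0 = inl e) /\ Phi x 0 = inl f).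
    have := fibE x; rewrite xf; apply; [by exists e|by exists f].
  apply: sub_finite_set (@finite_set0 _) => g [Ag [y yg yf]].
  by apply: nfib; exists y; split=> //; exists g.
- by left; rewrite (shift_space_const y0) PhiAB.
have AEe : (emitted (val A) `\` E) e by split=> // Ee; apply: nEe; left.
have [yB|[f Bf yf]] := imgE e AEe y ye; first by left.
right; exists f => //; split=> // Ff; apply: nEe; right.
by exists f => //; split=> //; exists y.
Qed.

End Const.

Theorem corollary3p22 (G H : ultragraph) (hG : no_sinks G) (hH : no_sinks H)
    (Phi : shift_space G -> shift_space H) :
  (continuous Phi /\ shift_commuting Phi /\ length_preserving Phi) <->
  exists C : alphabet H -> set (shift_space G),
    sliding_block_code_given_by Phi C /\
    edge_condition C /\
    emitter_condition C /\
    (forall (A : min_emitter G) (B : min_emitter H),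
       Phi (const_point A) = const_point B ->
       local_image_condition Phi A B /\ finite_fibre_condition Phi A B).
Proof.
split=> [[Phi_cont [Phi_shift Phi_len]]|[C [PhiC [edgeC [emitC constC]]]]].
  exists (fun a => [set x | Phi x 0 = a]); split.
    exact: continuous_sliding_block_code.
  split=> [f|].
    exact/open_union_of_cylinders/continuous_first_edge_open.
  have Phi_inl := length_preserving_first Phi_len.
  split=> [|A B PhiAB]; last first.
    by split; [apply: continuous_local_image|apply: continuous_finite_fibre].
  apply/seteqP; split=> x; rewrite shift_space0P.
    move=> [B _ /= xB]; have : ~~ is_inl (x 0) by rewrite -Phi_inl xB.
    by case: (x 0) => // A _; exists A.
  move=> [A xA]; have : ~~ is_inl (Phi x 0) by rewrite Phi_inl xA.
  by case xB: (Phi x 0) => [//|B] _; exists B.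
have Phi_shift := sliding_block_code_commuting PhiC.
have C0 x a : C a x <-> Phi x 0 = a by have [_ /(_ x 0)] := PhiC.
(* Condition (ii) makes emitters correspond to emitters in first position; by shift commutation this
   gives length preservation. *)
have Phi_inl x : is_inl (Phi x 0) = is_inl (x 0).
  have : (exists B, Phi x 0 = inr B) <-> exists A, x 0 = inr A.
    rewrite -(shift_space0P x) -emitC.
    by split=> [[B /C0 xB]|[B _ /C0 xB]]; exists B.
  by case: (x 0) (Phi x 0) => [e|A] [f|B] //= [BA AB];
    [case: BA => //; exists B|case: AB => //; exists A].
have Phi_len := first_length_preserving Phi_shift Phi_inl.
split; last by [].
apply: continuous_near_letter => // x F finF.
case xE: (Phi x 0) => [f|B].
  (* Nearness to an edge is equality, so condition (i) gives openness directly. *)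
  have -> : [set y | near_letter F (inl f) (Phi y 0)] = C (inl f).
    by apply/seteqP; split=> y /C0.
  apply: open_nbhs_nbhs; split; last exact/C0.
  exact/union_of_cylinders_open/edgeC.
have : ~~ is_inl (x 0) by rewrite -Phi_inl xE.
case xA: (x 0) => [//|A] _; rewrite (shift_space_const xA) in xE *.
have PhiAB := shift_space_const xE; have [imgAB fibAB] := constC _ _ PhiAB.
exact: near_const_letter.
Qed.
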